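(* For any integers $n, m \geq 2$, the super edge-magic deficiency of $K_{1,n} + \overline{K_m}$ satisfies \[\left\lceil \tfrac{1}{2}(n-1)(m-1)\right\rceil \leq \mu_s(K_{1,n} + \overline{K_m}) \leq n(m-1)-1.\]
   Context: All graphs are finite and simple. For a graph $G$ with $p=|V(G)|$ vertices and $q=|E(G)|$ edges, a super edge-magic labeling is a bijection $f: V(G)\cup E(G)\to\{1,2,\ldots,p+q\}$ with $f(V(G))=\{1,\ldots,p\}$ such that $f(x)+f(xy)+f(y)$ is the same constant for every edge $xy$; $G$ is super edge-magic if it has such a labeling. The super edge-magic deficiency $\mu_s(G)$ is the minimum nonnegative integer $t$ such that $G\cup tK_1$ (disjoint union of $G$ with $t$ isolated vertices) is super edge-magic, or $+\infty$ if no such $t$ exists. The join $G_1+G_2$ of two vertex-disjoint graphs is their union together with all edges joining a vertex of $G_1$ to a vertex of $G_2$. $K_{1,n}$ is the star with center $c$ and leaves $x_1,\ldots,x_n$, and $\overline{K_m}$ is the graph with $m$ vertices $y_1,\ldots,y_m$ and no edges; so $K_{1,n}+\overline{K_m}$ has edges $cx_i$, $x_iy_j$ and $cy_j$ for $1\le i\le n$, $1\le j\le m$. *)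

(* Defs.v *)
From mathcomp Require Import all_boot.
From mathcomp Require Import boolp.

Set Implicit Arguments.
Unset Strict Implicit.
Unset Printing Implicit Defensive.

Record sgraph := SGraph {
  vertex :> finType;
  adj : rel vertex;
  adj_sym : symmetric adj;
  adj_irrefl : irreflexive adj }.

Definition edges (G : sgraph) : {set {set G}} :=
  [set e | [exists x, exists y, adj x y && (e == [set x; y])]].

(* A labeling of V(G) ∪ E(G); an element of E(G) is a set of vertices together
   with a proof that it is an edge. *)
Definition labeling (G : sgraph) := (G + {e : {set G} | e \in edges G})%type -> nat.

Definition is_super_edge_magic_labeling (G : sgraph) (f : labeling G) : Prop :=
  [/\ injective f,
      forall k : nat, (exists z, f z = k) <-> 1 <= k <= #|G| + #|edges G|,
      forall k : nat, (exists v : G, f (inl v) = k) <-> 1 <= k <= #|G|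
    & exists c : nat, forall (x y : G) (e : {e : {set G} | e \in edges G}),
        val e = [set x; y] -> f (inl x) + f (inr e) + f (inl y) = c].

Definition super_edge_magic (G : sgraph) : Prop :=
  exists f : labeling G, is_super_edge_magic_labeling f.

Section Constructions.

Definition empty_adj (n : nat) : rel 'I_n := fun _ _ => false.

Lemma empty_adj_sym n : symmetric (@empty_adj n). Proof. by []. Qed.
Lemma empty_adj_irrefl n : irreflexive (@empty_adj n). Proof. by []. Qed.

(* n isolated vertices: both n K_1 and the complement of K_n *)
Definition empty_graph (n : nat) : sgraph :=
  SGraph (@empty_adj_sym n) (@empty_adj_irrefl n).

(* None is the center, Some i the leaves. *)
Definition star_adj (n : nat) : rel (option 'I_n) :=
  fun x y => isSome x != isSome y.

Lemma star_adj_sym n : symmetric (@star_adj n).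
Proof. by move=> x y; rewrite /star_adj eq_sym. Qed.
Lemma star_adj_irrefl n : irreflexive (@star_adj n).
Proof. by move=> x; rewrite /star_adj eqxx. Qed.

Definition star (n : nat) : sgraph :=
  SGraph (@star_adj_sym n) (@star_adj_irrefl n).

Variables G H : sgraph.

Definition dunion_adj : rel (G + H) := fun u v =>
  match u, v with
  | inl x, inl y => adj x y
  | inr x, inr y => adj x y
  | _, _ => false
  end.

Lemma dunion_adj_sym : symmetric dunion_adj.
Proof. by case=> x [] y //=; rewrite adj_sym. Qed.
Lemma dunion_adj_irrefl : irreflexive dunion_adj.
Proof. by case=> x /=; rewrite adj_irrefl. Qed.

Definition dunion : sgraph := SGraph dunion_adj_sym dunion_adj_irrefl.

Definition join_adj : rel (G + H) := fun u v =>
  match u, v with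
  | inl x, inl y => adj x y
  | inr x, inr y => adj x y
  | _, _ => true
  end.

Lemma join_adj_sym : symmetric join_adj.
Proof. by case=> x [] y //=; rewrite adj_sym. Qed.
Lemma join_adj_irrefl : irreflexive join_adj.
Proof. by case=> x /=; rewrite adj_irrefl. Qed.

Definition join : sgraph := SGraph join_adj_sym join_adj_irrefl.

End Constructions.

(* Natural numbers extended with +oo, represented by None. *)
Definition enat := option nat.

Definition le_enat (a b : enat) : bool :=
  match a, b with
  | _, None => true
  | None, Some _ => false
  | Some k, Some l => k <= l
  end.

Definition super_edge_magic_deficiency (G : sgraph) : enat :=
  if pselect (exists t, `[< super_edge_magic (dunion G (empty_graph t)) >])
    is left ex_t then Some (ex_minn ex_t) else None.

(* Main.v *)
Require Import Defs.
From mathcomp Require Import all_boot zify.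
From mathcomp Require Import boolp.

Set Implicit Arguments.
Unset Strict Implicit.
Unset Printing Implicit Defensive.

(** Lower bound: in a super edge-magic graph the sums f(x) + f(y) over the edges
    xy are pairwise distinct and lie between 3 and 2p - 1, so q <= 2p - 3; for
    the join with t isolated vertices added this reads (n - 1)(m - 1) <= 2t.

    Upper bound: a vertex numbering by 1, ..., p whose edge sums are distinct and
    lie in an interval of length q extends to the edges by complementing the sum.
    Take c = n + 1, x_i = n + 2 + i, y_0 = 1 and y_j = (n + 1)(j + 1) for j > 0
    (indices from 0).  The sums of y_j with c and the x_i form a block of n + 1
    consecutive integers; the block of y_0 ends at 2n + 2, the sums c + x_i fill
    the gap 2n + 3, ..., 3n + 2, and the remaining blocks follow without gaps.
    The largest label is m(n + 1), leaving n(m - 1) - 1 unused labels. *)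

(** * Injective numberings of a finite type *)

Lemma inj_bounded_onto (T : finType) (f : T -> nat) :
  injective f -> (forall x, 1 <= f x <= #|T|) ->
  forall k, (exists x, f x = k) <-> 1 <= k <= #|T|.
Proof.
move=> f_inj f_bnd k; split=> [[x <-] //|k_bnd].
have [|||_ eq_s] := @uniq_min_size _ (map f (enum T)) (iota 1 #|T|).
- by rewrite map_inj_uniq ?enum_uniq.
- by move=> _ /mapP[x _ ->]; rewrite mem_iota add1n ltnS.
- by rewrite size_map size_iota -cardE.
have: k \in map f (enum T) by rewrite eq_s mem_iota add1n ltnS.
by case/mapP=> x _ ->; exists x.
Qed.

(** At most [#|T|] integers of [1, ..., #|T| + t] are values of [g], so at least [t] remain; [h]
    lists the first [t] of these. *)
Lemma inj_extend_ord (T : finType) (t : nat) (g : T -> nat) :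
  injective g -> (forall x, 1 <= g x <= #|T| + t) ->
  exists2 h : 'I_t -> nat,
    injective h & forall i, 1 <= h i <= #|T| + t /\ forall x, g x <> h i.
Proof.
move=> g_inj g_bnd.
pose s := iota 1 (#|T| + t).
pose r := [seq k <- s | k \notin codom g].
have r_size : t <= size r.
  have: size [seq k <- s | k \in codom g] <= #|T|.
    rewrite -(size_codom g); apply: uniq_leq_size => [|k].
      by rewrite filter_uniq ?iota_uniq.
    by rewrite mem_filter => /andP[].
  have := count_predC [in codom g] s.
  by rewrite -!size_filter size_iota -/r; lia.
have r_lt (i : 'I_t) : i < size r by apply: leq_trans r_size.
exists (fun i => nth 0 r i) => [i j /eqP|i].
  by rewrite nth_uniq ?filter_uniq ?iota_uniq // => /eqP/val_inj.
have := mem_nth 0 (r_lt i); rewrite mem_filter mem_iota add1n ltnS.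
case/andP=> out bnd; split=> // x gx.
by rewrite -gx codom_f in out.
Qed.

(** * Edge sums of vertex numberings *)

Section Edges.
Variable G : sgraph.

Lemma mem_edges (x y : G) : ([set x; y] \in edges G) = adj x y.
Proof.
rewrite inE; apply/existsP/idP => [[a /existsP[b /andP[ab /eqP eq_e]]]|xy].
  have /set2P[] : x \in [set a; b] by rewrite -eq_e set21.
    move=> xa; have /set2P[] : b \in [set x; y] by rewrite eq_e set22.
      by move=> bx; rewrite bx xa adj_irrefl in ab.
    by move=> <-; rewrite xa.
  move=> xb; have /set2P[] : a \in [set x; y] by rewrite eq_e set21.
    by move=> ax; rewrite ax xb adj_irrefl in ab.
  by move=> <-; rewrite xb adj_sym.
by exists x; apply/existsP; exists y; rewrite xy eqxx.
Qed.

Lemma edgesP (e : {set G}) :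
  reflect (exists x y, adj x y /\ e = [set x; y]) (e \in edges G).
Proof.
apply: (iffP idP) => [|[x [y [xy ->]]]]; last by rewrite mem_edges.
rewrite inE => /existsP[x /existsP[y /andP[xy /eqP->]]].
by exists x, y.
Qed.

Lemma adj_neq (x y : G) : adj x y -> x != y.
Proof. by apply: contraTneq => ->; rewrite adj_irrefl. Qed.

Lemma sum_edge (g : G -> nat) (x y : G) :
  adj x y -> \sum_(v in [set x; y]) g v = g x + g y.
Proof. by move=> /adj_neq xy; rewrite big_setU1 ?inE // big_set1. Qed.

Lemma super_edge_magic_card_edges :
  super_edge_magic G -> #|edges G| <= #|G|.*2 - 3.
Proof.
case=> f [f_inj _ f_vert [c f_c]].
have bnd v : 1 <= f (inl v) <= #|G| by apply/f_vert; exists v.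
have sum_bnd (e : {e : {set G} | e \in edges G}) :
    3 <= c - f (inr e) < #|G|.*2 /\ f (inr e) <= c.
  have /edgesP[x [y [xy def_e]]] := valP e.
  have := f_c _ _ _ def_e; have := bnd x; have := bnd y.
  (* Distinct endpoint labels sharpen the bounds on their sum from 2 and 2p to 3 and 2p - 1. *)
  have : f (inl x) <> f (inl y) by move/f_inj => [] /eqP; apply/negP/adj_neq.
  lia.
rewrite -card_sig cardE -(size_map (fun e => c - f (inr e))).
rewrite -(size_iota 3 (_ - 3)); apply: uniq_leq_size => [|k].
  rewrite map_inj_uniq ?enum_uniq // => e e' /= eq_ee'.
  (* Truncated subtraction from [c] can be undone because both edge labels are at most [c]. *)
  have [_ le_e] := sum_bnd e; have [_ le_e'] := sum_bnd e'.
  suff: f (inr e) = f (inr e') by move/f_inj => [].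
  by rewrite -(subKn le_e) eq_ee' subKn.
by case/mapP=> e _ ->; have [+ _] := sum_bnd e; rewrite mem_iota; lia.
Qed.

Lemma super_edge_magic_of_edge_sums (g : G -> nat) (s : nat) :
  injective g -> (forall v, 1 <= g v <= #|G|) ->
  {in edges G &, injective (fun e : {set G} => \sum_(v in e) g v)} ->
  {in edges G, forall e : {set G}, s <= \sum_(v in e) g v < s + #|edges G|} ->
  super_edge_magic G.
Proof.
move=> g_inj g_bnd sum_inj sum_bnd.
(* The magic constant: sums from [s] to [s + q - 1] are sent to edge labels from [p + q] down to
   [p + 1]. *)
pose top := #|G| + (s + #|edges G|).
pose esum (e : {e : {set G} | e \in edges G}) := \sum_(v in val e) g v.
pose f : labeling G := fun z =>
  match z with inl v => g v | inr e => top - esum e end.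
have bnd_e e : s <= esum e < s + #|edges G| by exact: sum_bnd (valP e).
have f_inj : injective f.
  case=> [x|e] [y|e'] /=.
  - by move/g_inj->.
  - by have := bnd_e e'; have := g_bnd x; rewrite /top; lia.
  - by have := bnd_e e; have := g_bnd y; rewrite /top; lia.
  - move=> eq_ee'; congr inr; apply/val_inj/sum_inj; try exact: valP.
    rewrite -/(esum e) -/(esum e').
    by move: eq_ee' (bnd_e e) (bnd_e e'); rewrite /top; lia.
have card_dom : #|{: G + {e : {set G} | e \in edges G}}| = #|G| + #|edges G|.
  by rewrite card_sum card_sig.
exists f; split=> //.
- rewrite -card_dom; apply: inj_bounded_onto => // -[v|e] /=; rewrite card_dom.
    by have := g_bnd v; lia.
  by have := bnd_e e; rewrite /top; lia.
- exact: inj_bounded_onto.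
- exists top => x y e def_e.
  have xy : adj x y by rewrite -mem_edges -def_e (valP e).
  have sum_e : esum e = g x + g y by rewrite /esum def_e sum_edge.
  by have := bnd_e e; rewrite /f /top sum_e; lia.
Qed.

End Edges.

(** * Adding isolated vertices *)

Section Isolated.
Variables (G : sgraph) (t : nat).

Lemma edges_dunion_empty :
  edges (dunion G (empty_graph t)) =
  [set [set inl v | v in e] | e : {set G} in edges G].
Proof.
apply/setP=> e; apply/edgesP/imsetP.
  case=> [[x|i]] [[y|j]] [] // xy ->; exists [set x; y]; rewrite ?mem_edges //.
  by rewrite imsetU1 imset_set1.
case=> _ /edgesP[x [y [xy ->]]] ->; exists (inl x), (inl y); split=> //.
by rewrite imsetU1 imset_set1.
Qed.

Lemma card_edges_dunion_empty :
  #|edges (dunion G (empty_graph t))| = #|edges G|.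
Proof.
by rewrite edges_dunion_empty card_imset //; apply: imset_inj; apply: inl_inj.
Qed.

Lemma super_edge_magic_dunion_empty (g : G -> nat) (s : nat) :
  injective g -> (forall v, 1 <= g v <= #|G| + t) ->
  {in edges G &, injective (fun e : {set G} => \sum_(v in e) g v)} ->
  {in edges G, forall e : {set G}, s <= \sum_(v in e) g v < s + #|edges G|} ->
  super_edge_magic (dunion G (empty_graph t)).
Proof.
move=> g_inj g_bnd sum_inj sum_bnd.
have [h h_inj h_bnd] := inj_extend_ord g_inj g_bnd.
pose g' (v : dunion G (empty_graph t)) :=
  match v with inl x => g x | inr i => h i end.
have sum_g' (e : {set G}) :
    \sum_(v in [set (inl v : dunion G (empty_graph t)) | v in e]) g' v
    = \sum_(v in e) g v.
  by rewrite big_imset //= => x y _ _ [].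
apply: (@super_edge_magic_of_edge_sums _ g' s).
- case=> [x|i] [y|j] /=.
  + by move/g_inj->.
  + by case: (h_bnd j) => _ /[apply].
  + by move/esym; case: (h_bnd i) => _ /[apply].
  + by move/h_inj->.
- by case=> [x|i]; rewrite card_sum card_ord //=; case: (h_bnd i).
- rewrite edges_dunion_empty => _ _ /imsetP[e eG ->] /imsetP[e' eG' ->].
  by rewrite !sum_g' => /sum_inj->.
- rewrite card_edges_dunion_empty edges_dunion_empty => _ /imsetP[e eG ->].
  by rewrite sum_g' sum_bnd.
Qed.

End Isolated.

(** * The join of a star with an empty graph *)

Section StarJoin.
Variables n m : nat.
Let G := join (star n) (empty_graph m).

(** Indexing the edges turns counting them and comparing their sums into arithmetic on indices. *)
Definition star_join_edge (k : 'I_n + option 'I_n * 'I_m) : {set G} :=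
  match k with
  | inl i => [set inl None; inl (Some i)]
  | inr (a, j) => [set inl a; inr j]
  end.

Lemma star_join_edge_inj : injective star_join_edge.
Proof.
case=> [i|[a j]] [i'|[a' j']] /= /setP eq_e.
- by have := eq_e (inl (Some i)); rewrite !inE eqxx => /esym/eqP[->].
- by have := eq_e (inr j'); rewrite !inE eqxx orbT.
- by have := eq_e (inr j); rewrite !inE eqxx orbT.
- have := eq_e (inr j); rewrite !inE eqxx => /esym/eqP[->].
  by have := eq_e (inl a); rewrite !inE eqxx => /esym; rewrite orbF => /eqP[->].
Qed.

Lemma edges_star_join : edges G = star_join_edge @: setT.
Proof.
apply/setP=> e; apply/edgesP/imsetP.
  case=> [[[i|]|j]] [[[i'|]|j']] [] //= _ ->.
  - by exists (inl i); rewrite // setUC.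
  - by exists (inr (Some i, j')).
  - by exists (inl i').
  - by exists (inr (None, j')).
  - by exists (inr (Some i', j)); rewrite // setUC.
  - by exists (inr (None, j)); rewrite // setUC.
case=> -[i|[a j]] _ ->; first by exists (inl None), (inl (Some i)).
by exists (inl a), (inr j).
Qed.

Lemma card_edges_star_join : #|edges G| = n + n.+1 * m.
Proof.
rewrite edges_star_join card_imset; last exact: star_join_edge_inj.
by rewrite cardsT card_sum card_prod card_option !card_ord.
Qed.

Lemma card_star_join : #|G| = n.+1 + m.
Proof. by rewrite card_sum card_option !card_ord. Qed.

(** At [j = 0] the general formula would repeat the label [n.+1] of the center, hence the
    exception. *)
Definition star_join_label (v : G) : nat :=
  match v with
  | inl None => n.+1
  | inl (Some i) => n.+2 + i
  | inr j => if j == 0 :> nat then 1 else n.+1 * j.+1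
  end.

Definition star_join_sum (k : 'I_n + option 'I_n * 'I_m) : nat :=
  match k with
  | inl i => n.+1 + (n.+2 + i)
  | inr (a, j) => star_join_label (inl a) + star_join_label (inr j)
  end.

Lemma sum_star_join_edge k :
  \sum_(v in star_join_edge k) star_join_label v = star_join_sum k.
Proof. by case: k => [i|[a j]]; apply: (@sum_edge G). Qed.

Lemma star_join_label_inl_inj :
  injective (fun a : option 'I_n => star_join_label (inl a)).
Proof.
case=> [i|] [i'|] //= eq_l; try lia.
by congr Some; apply: val_inj => /=; lia.
Qed.

(** The star labels lie in a window of length [n.+1] just below the label of the second [y]; this
    keeps the blocks of sums disjoint. *)
Lemma star_join_label_inl_bounds (a : option 'I_n) :
  n < star_join_label (inl a) < n.+1.*2.
Proof. by case: a => [i|] /=; [have := ltn_ord i|]; lia. Qed.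

Lemma star_join_label_inj : 0 < n -> injective star_join_label.
Proof.
move=> n_gt0 [a|j] [a'|j'] eq_l.
- by congr inl; apply: star_join_label_inl_inj.
- by move: eq_l (star_join_label_inl_bounds a) => -> /=; case: eqP; nia.
- by move: eq_l (star_join_label_inl_bounds a') => <- /=; case: eqP; nia.
- by congr inr; apply: val_inj; move: eq_l => /=; do 2![case: eqP]; nia.
Qed.

Lemma star_join_label_bounds (v : G) :
  2 <= m -> 1 <= star_join_label v <= m * n.+1.
Proof.
move=> m_ge2; case: v => [[i|]|j] /=.
- by have := ltn_ord i; nia.
- by nia.
- by have := ltn_ord j; case: eqP; nia.
Qed.

Lemma star_join_sum_inj : injective star_join_sum.
Proof.
case=> [i|[a j]] [i'|[a' j']]; rewrite /star_join_sum => eq_s.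
- by congr inl; apply: val_inj => /=; lia.
- move: eq_s (star_join_label_inl_bounds a') (ltn_ord i).
  by move: (star_join_label (inl a')) => u /=; case: eqP; nia.
- move: eq_s (star_join_label_inl_bounds a) (ltn_ord i').
  by move: (star_join_label (inl a)) => u /=; case: eqP; nia.
(* Blocks with different [j] are disjoint, so the sum determines [j]; cancelling the label of that
   [y] then leaves the star label. *)
- have eq_j : j = j'.
    apply: val_inj; move: eq_s.
    move: (star_join_label_inl_bounds a) (star_join_label_inl_bounds a').
    move: (star_join_label (inl a)) (star_join_label (inl a')) => u u' /=.
    by do 2![case: eqP] => /=; case: (ltngtP j j') => //; nia.
  congr (inr (_, _)) => //; apply: star_join_label_inl_inj.
  by move: eq_s; rewrite eq_j => /addIn.
Qed.

(** The least sum is that of the center and the first [y], the greatest that of the last leaf and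
    the last [y]. *)
Lemma star_join_sum_bounds k :
  2 <= m -> n.+2 <= star_join_sum k < n.+2 + (n + n.+1 * m).
Proof.
move=> m_ge2; case: k => [i|[[i|] j]] /=.
- by have := ltn_ord i; nia.
- by have := ltn_ord i; have := ltn_ord j; case: eqP; nia.
- by have := ltn_ord j; case: eqP; nia.
Qed.

Lemma super_edge_magic_star_join :
  2 <= n -> 2 <= m ->
  super_edge_magic (dunion G (empty_graph (n * (m - 1) - 1))).
Proof.
move=> n_ge2 m_ge2.
apply: (@super_edge_magic_dunion_empty _ _ star_join_label n.+2).
- by apply: star_join_label_inj; lia.
(* The number of vertices with the isolated ones is exactly [m * n.+1]. *)
- move=> v; have := star_join_label_bounds v m_ge2; rewrite card_star_join; nia.
- rewrite edges_star_join => _ _ /imsetP[k _ ->] /imsetP[k' _ ->].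
  by rewrite !sum_star_join_edge => /star_join_sum_inj->.
- rewrite card_edges_star_join edges_star_join => _ /imsetP[k _ ->].
  by rewrite sum_star_join_edge star_join_sum_bounds.
Qed.

End StarJoin.

(* uphalf k is the ceiling of k / 2. *)
Theorem theorem4 (n m : nat) (n_ge2 : 2 <= n) (m_ge2 : 2 <= m) :
  le_enat (Some (uphalf ((n - 1) * (m - 1))))
          (super_edge_magic_deficiency (join (star n) (empty_graph m))) /\
  le_enat (super_edge_magic_deficiency (join (star n) (empty_graph m)))
          (Some (n * (m - 1) - 1)).
Proof.
have sem := super_edge_magic_star_join n_ge2 m_ge2.
(* The labeling just built rules out an infinite deficiency and bounds the minimum from above. *)
rewrite /super_edge_magic_deficiency; case: pselect => [ex_t|[]]; last first.
  by exists (n * (m - 1) - 1); apply/asboolP.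
case: ex_minnP => t /asboolP sem_t t_min /=; split; last exact/t_min/asboolP.
have := super_edge_magic_card_edges sem_t.
rewrite card_edges_dunion_empty card_edges_star_join.
rewrite card_sum card_star_join card_ord leq_uphalf_double; nia.
Qed.
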